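(* Let $P \subseteq [0,1]^n$ be a solvable convex body, let $G\colon [0,1]^n \to \mathbb{R}$ be a non-negative, monotone, $L$-smooth DR-submodular function, let $C\colon [0,1]^n \to \mathbb{R}$ be a non-negative $L$-smooth concave function, and let $F = G + C$. Let $\mathbf{o} \in \arg\max_{\mathbf{x}\in P} F(\mathbf{x})$, $D = \max_{\mathbf{x}\in P}\|\mathbf{x}\|_2$, and let $\varepsilon \in (0,1/4)$ be such that $\varepsilon^{-1}$ is an integer. Let $S$ be the time it takes to find a point in $P$ maximizing a given linear function. Then the algorithm Non-Oblivious Frank-Wolfe (defined in the context) with parameter $\varepsilon$ runs in $O(\varepsilon^{-2}(n/\varepsilon+S)\ln\varepsilon^{-1})$ time, makes $O(\varepsilon^{-3}\ln\varepsilon^{-1})$ gradient oracle calls (to the gradient oracles of $G$ and $C$), and outputs a vector $\mathbf{y}$ such that $$F(\mathbf{y}) \ge (1-1/e-4\varepsilon\ln\varepsilon^{-1})\cdot G(\mathbf{o}) + (1-4\varepsilon\ln\varepsilon^{-1})\cdot C(\mathbf{o}) - 4\varepsilon L D^2.$$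
   Context: Inequalities between vectors hold coordinate-wise; $\langle\cdot,\cdot\rangle$ is the standard Euclidean inner product; $\mathbf{e}_i$ is the $i$-th standard basis vector. A function $G\colon[0,1]^n\to\mathbb{R}$ is DR-submodular if for all $\mathbf{a},\mathbf{b}\in[0,1]^n$ with $\mathbf{a}\le\mathbf{b}$, every $k>0$ and every $i\in\{1,\dots,n\}$ with $\mathbf{a}+k\mathbf{e}_i,\mathbf{b}+k\mathbf{e}_i\in[0,1]^n$, one has $G(\mathbf{a}+k\mathbf{e}_i)-G(\mathbf{a})\ge G(\mathbf{b}+k\mathbf{e}_i)-G(\mathbf{b})$. A function $f$ is $L$-smooth if it is differentiable and $\|\nabla f(\mathbf{a})-\nabla f(\mathbf{b})\|_2\le L\|\mathbf{a}-\mathbf{b}\|_2$ for all $\mathbf{a},\mathbf{b}\in[0,1]^n$. A function $f$ is monotone if $\mathbf{a}\le\mathbf{b}$ implies $f(\mathbf{a})\le f(\mathbf{b})$. $P$ is solvable if one can efficiently optimize linear functions over it. $O(\cdot)$ hides universal constants; oracle calls are counted separately from the running time. Auxiliary function: $\bar G(\mathbf{x})=\varepsilon\cdot\sum_{j=1}^{\varepsilon^{-1}}\frac{e^{\varepsilon j}\cdot G(\varepsilon j\cdot\mathbf{x})}{\varepsilon j}$ for $\mathbf{x}\in[0,1]^n$. A call to the gradient oracle of $\bar G$ is simulated using $\varepsilon^{-1}$ calls to the gradient oracle of $G$. Algorithm Non-Oblivious Frank-Wolfe ($\varepsilon$): let $\mathbf{y}^{(0)}$ be an arbitrary vector in $P$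 and let $\beta(\varepsilon)=e(1-\ln\varepsilon)$. For $i=0,1,\dots,\lceil e^{-1}\beta(\varepsilon)/\varepsilon^2\rceil$: let $\mathbf{s}^{(i)}\in\arg\max_{\mathbf{x}\in P}\langle e^{-1}\nabla\bar G(\mathbf{y}^{(i)})+\nabla C(\mathbf{y}^{(i)}),\mathbf{x}\rangle$; set $\mathbf{y}^{(i+1)}\gets(1-\varepsilon)\cdot\mathbf{y}^{(i)}+\varepsilon\cdot\mathbf{s}^{(i)}$. Return the vector maximizing $F$ among $\{\mathbf{y}^{(0)},\dots,\mathbf{y}^{(\lceil e^{-1}\beta(\varepsilon)/\varepsilon^2\rceil)}\}$. *)

(* Defs.v *)
From HB Require Import structures.
From mathcomp Require Import all_boot all_order all_algebra.
From mathcomp Require Import all_classical all_reals all_analysis.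
Set Implicit Arguments.
Unset Strict Implicit.
Unset Printing Implicit Defensive.
Import Order.TTheory GRing.Theory Num.Theory.
Import numFieldNormedType.Exports.
Local Open Scope classical_set_scope.
Local Open Scope ring_scope.

(** * Functions on the cube [0,1]^n *)

(** A function [0,1]^n -> R is a total function on row vectors of which only
    the values on [cube] matter. *)
Definition cube (R : realType) (n : nat) : set 'rV[R]_n :=
  [set x | forall i, 0 <= x 0 i <= 1].
Arguments cube {R n}.

Definition vle (R : realType) (n : nat) (a b : 'rV[R]_n) : Prop :=
  forall i, a 0 i <= b 0 i.

Definition dot (R : realType) (n : nat) (u v : 'rV[R]_n) : R :=
  \sum_i u 0 i * v 0 i.

(** The library norm on ['rV[R]_n] is the sup norm, hence this definition. *)
Definition norm2 (R : realType) (n : nat) (u : 'rV[R]_n) : R :=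
  Num.sqrt (dot u u).

Definition nonnegative (R : realType) (n : nat) (f : 'rV[R]_n -> R) : Prop :=
  forall a, cube a -> 0 <= f a.

Definition cube_monotone (R : realType) (n : nat) (f : 'rV[R]_n -> R) : Prop :=
  forall a b, cube a -> cube b -> vle a b -> f a <= f b.

Definition dr_submodular (R : realType) (n : nat) (f : 'rV[R]_n -> R) : Prop :=
  forall (a b : 'rV[R]_n) (k : R) (i : 'I_n),
    cube a -> cube b -> vle a b -> 0 < k ->
    cube (a + k *: delta_mx 0 i) -> cube (b + k *: delta_mx 0 i) ->
    f (b + k *: delta_mx 0 i) - f b <= f (a + k *: delta_mx 0 i) - f a.

Definition concave (R : realType) (n : nat) (f : 'rV[R]_n -> R) : Prop :=
  convex_function (cube : set 'rV[R]_n) (fun x => - f x).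

(** Fréchet gradient of [f] relative to the cube: since [f] lives on [0,1]^n
    only, at a boundary point the increments stay inside the cube. *)
Definition is_gradient (R : realType) (n : nat) (f : 'rV[R]_n -> R)
    (a g : 'rV[R]_n) : Prop :=
  forall eta : R, 0 < eta ->
    \forall b \near within cube (nbhs a),
      `|f b - f a - dot g (b - a)| <= eta * norm2 (b - a).

(** The cube spans all directions at each of its points, so for [a] in the cube
    at most one vector satisfies [is_gradient f a]; junk value 0 if none does. *)
Definition gradient (R : realType) (n : nat) (f : 'rV[R]_n -> R)
    (a : 'rV[R]_n) : 'rV[R]_n :=
  xget 0 [set g | is_gradient f a g].

Definition smooth (R : realType) (n : nat) (L : R) (f : 'rV[R]_n -> R) : Prop :=
  (forall a, cube a -> exists g, is_gradient f a g) /\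
  (forall a b, cube a -> cube b ->
    norm2 (gradient f a - gradient f b) <= L * norm2 (a - b)).

Definition convex_body (R : realType) (n : nat) (P : set 'rV[R]_n) : Prop :=
  [/\ P !=set0, compact P & convex_set P].

Definition argmax (R : realType) (T : Type) (A : set T) (f : T -> R) : set T :=
  [set x | A x /\ forall z, A z -> f z <= f x].

(** * The algorithm *)

(** Meant for [eps^-1] an integer, which is then [Num.truncn eps^-1]. *)
Definition barG (R : realType) (n : nat) (eps : R) (G : 'rV[R]_n -> R)
    (x : 'rV[R]_n) : R :=
  eps * \sum_(1 <= j < (Num.truncn eps^-1).+1)
          (expR (eps * j%:R) * G ((eps * j%:R) *: x) / (eps * j%:R)).

Definition fw_beta (R : realType) (eps : R) : R := expR 1 * (1 - ln eps).

Definition last_index (R : realType) (eps : R) : nat :=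
  `|Num.ceil ((expR 1)^-1 * fw_beta eps / eps ^+ 2)|%N.

(** [frank_wolfe eps P G C v]: the algorithm may output [v], the arbitrary
    choices being [y 0], the linear maximizers [s i] and the final maximizer. *)
Definition frank_wolfe (R : realType) (n : nat) (eps : R) (P : set 'rV[R]_n)
    (G C : 'rV[R]_n -> R) (v : 'rV[R]_n) : Prop :=
  exists y s : nat -> 'rV[R]_n,
    [/\ P (y 0%N),
        forall i, (i <= last_index eps)%N ->
          argmax P (dot ((expR 1)^-1 *: gradient (barG eps G) (y i)
                         + gradient C (y i))) (s i),
        forall i, (i <= last_index eps)%N ->
          y i.+1 = (1 - eps) *: y i + eps *: s i &
        argmax [set y i | i in [set i | (i <= last_index eps)%N]] (G \+ C) v].

(** * Cost model *)

(** Oracle calls are counted separately from the elementary steps. *)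
Record cost := Cost { time : nat; grad_calls : nat; value_calls : nat }.

Definition add_cost (c d : cost) : cost :=
  Cost (time c + time d)%N (grad_calls c + grad_calls d)%N
       (value_calls c + value_calls d)%N.

Definition steps (k : nat) : cost := Cost k 0 0.

(** A nondeterministic computation is the set of its possible results, each
    paired with the cost of reaching it. *)
Definition comp (T : Type) := set (T * cost).

(** Any result in [A], at cost [c]. *)
Definition pick (T : Type) (A : set T) (c : cost) : comp T :=
  [set p | A p.1 /\ p.2 = c].

(** [ops k x] is [x], computed in [k] elementary steps.  The machine is a unit
    cost real RAM: one step per scalar operation (+, -, *, /, exp, ln, rounding,
    integer conversion, comparison), so an operation on vectors of length [n]
    takes [n] steps. *)
Definition ops (T : Type) (k : nat) (x : T) : comp T := pick [set x] (steps k).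

Definition bind (T U : Type) (m : comp T) (f : T -> comp U) : comp U :=
  [set p | exists (x : T) (c d : cost),
     [/\ m (x, c), f x (p.1, d) & p.2 = add_cost c d]].

Notation "'let*' x ':=' m 'in' k" := (bind m (fun x => k))
  (at level 200, x name, m at level 200, k at level 200).

(** Runs [body i], ..., [body (i + k - 1)]; one step per loop test. *)
Fixpoint loop (T : Type) (body : nat -> T -> comp T) (i k : nat) (x : T) :
    comp T :=
  if k is k'.+1 then
    let* _ := ops 1 tt in
    let* x' := body i x in
    loop body i.+1 k' x'
  else ops 1 x.

Definition gradient_oracle (R : realType) (n : nat) (f : 'rV[R]_n -> R)
    (x : 'rV[R]_n) : comp 'rV[R]_n :=
  pick [set gradient f x] (Cost 0 1 0).

Definition value_oracle (R : realType) (n : nat) (f : 'rV[R]_n -> R)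
    (x : 'rV[R]_n) : comp R :=
  pick [set f x] (Cost 0 0 1).

Definition linear_solver (R : realType) (n : nat) (S : nat) (P : set 'rV[R]_n)
    (u : 'rV[R]_n) : comp 'rV[R]_n :=
  pick (argmax P (dot u)) (steps S).

(** Simulates one call to the gradient oracle of [barG eps G]: by the chain
    rule, the gradient of [barG eps G] at [x] is
    eps * \sum_j e^(eps j) * (gradient of [G] at [(eps j) x]). *)
Definition barG_gradient (R : realType) (n : nat) (eps : R)
    (G : 'rV[R]_n -> R) (x : 'rV[R]_n) : comp 'rV[R]_n :=
  let* m := ops 2 (Num.truncn eps^-1) in
  let* g0 := ops n (0 : 'rV[R]_n) in
  let* g := loop (fun j acc =>
      let* t := ops 2 (eps * j%:R) in
      let* z := ops n (t *: x) in
      let* g := gradient_oracle G z in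
      let* w := ops 1 (expR t) in
      let* h := ops n (w *: g) in
      ops n (acc + h)) 1 m g0 in
  ops n (eps *: g).

(** One iteration; the state is the current point and the list of the previous
    ones. *)
Definition frank_wolfe_step (R : realType) (n S : nat) (eps : R)
    (P : set 'rV[R]_n) (G C : 'rV[R]_n -> R)
    (st : 'rV[R]_n * seq 'rV[R]_n) : comp ('rV[R]_n * seq 'rV[R]_n) :=
  let* gG := barG_gradient eps G st.1 in
  let* gC := gradient_oracle C st.1 in
  let* u := ops (2 + 2 * n)%N ((expR 1)^-1 *: gG + gC) in
  let* s := linear_solver S P u in
  let* y := ops (1 + 3 * n)%N ((1 - eps) *: st.1 + eps *: s) in
  ops 1 (y, st.1 :: st.2).

Definition objective (R : realType) (n : nat) (G C : 'rV[R]_n -> R)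
    (x : 'rV[R]_n) : comp R :=
  let* a := value_oracle G x in
  let* b := value_oracle C x in
  ops 1 (a + b).

(** Keeps the better of two points, each given with its value. *)
Definition better (R : realType) (T : Type) (p q : T * R) : comp (T * R) :=
  pick (argmax [set p; q] snd) (steps 1).

Definition best (R : realType) (n : nat) (G C : 'rV[R]_n -> R)
    (y : 'rV[R]_n) (ys : seq 'rV[R]_n) : comp 'rV[R]_n :=
  let* v := objective G C y in
  let* p := foldl (fun m z =>
      let* p := m in
      let* w := objective G C z in
      better p (z, w)) (ops 0 (y, v)) ys in
  ops 0 p.1.

(** All points of [P] maximize the zero function, so one call to the linear
    solver yields an arbitrary starting point.  The point computed by the very
    last iteration is not a candidate for the output. *)
Definition frank_wolfe_program (R : realType) (n S : nat) (eps : R)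
    (P : set 'rV[R]_n) (G C : 'rV[R]_n -> R) : comp 'rV[R]_n :=
  let* u := ops n (0 : 'rV[R]_n) in
  let* y0 := linear_solver S P u in
  let* N := ops 10 (last_index eps) in
  let* st := loop (fun _ st => frank_wolfe_step S eps P G C st)
                  0 N.+1 (y0, [::]) in
  best G C (head y0 st.2) (behead st.2).

(* Main.v *)
Require Import Defs.
From HB Require Import structures.
From mathcomp Require Import all_boot all_order all_algebra.
From mathcomp Require Import all_classical all_reals all_analysis.
From mathcomp Require Import ring lra zify.
Set Implicit Arguments.
Unset Strict Implicit.
Unset Printing Implicit Defensive.
Import Order.TTheory GRing.Theory Num.Theory.
Import numFieldNormedType.Exports.
Local Open Scope classical_set_scope.
Local Open Scope ring_scope.

(** The algorithm is plain Frank-Wolfe on the potential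
    [phi = e^-1 * barG + C], and its guarantee comes from two facts about [phi].

    First, at every point [y] of the body the direction towards the optimum [o]
    has slope at least [(1 - 1/e) G o + C o - (1 + eps) G y - C y]
    ([barG_progress] for [G], the tangent inequality of concavity for [C]).  For
    [G] this rests on diminishing returns: together with monotonicity they give
    [<o, grad G z> >= G o - G z] for every [z] ([dr_gradient_target]), and they
    make [G] concave along the ray through [y], so that
    [<y, grad G (eps j y)>] is at most a difference quotient of [G] on that ray
    ([dr_gradient_upper]); the exponential weights of [barG] turn the sum over
    [j] into a telescoping one.

    Second, [phi] is nonnegative and at most [(1 - ln eps) F] on the body, by
    the harmonic sum bound ([barG_le]), hence at most [(1 - ln eps) F o].

    The gradient of [phi] is [2 L]-Lipschitz and two points of the body are at
    squared distance at most [2 D^2], so one iteration increases [phi] by at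
    least [eps] times the slope, up to [4 eps^2 L D^2] ([phi_step]).  If every
    iterate had a small value of [F], the more than [(1 - ln eps) / eps^2]
    iterations would push [phi] above its upper bound; hence the best iterate
    satisfies the guarantee with [2 eps] in place of [4 eps ln eps^-1], and
    [ln eps^-1 >= 3/4] concludes.

    Gradients are relative to the cube, so that everything is done with
    increments along segments of the cube: [gradient_segment] reduces each use
    of differentiability to a function of one real variable.  This yields
    uniqueness of gradients, and therefore the explicit formula for the gradient
    of [barG] that the program evaluates ([barG_is_gradient]).

    The program is analysed by a total-correctness judgement that carries exact
    costs, [outputs m Q t g]; its rules for sequencing and loops produce the
    running time and the number of gradient calls as closed expressions, which
    [iterations_bound] and [total_time_bound] then estimate. *)

(** * Inner product *)

Section InnerProduct.
Context {R : realType} {n : nat}.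
Implicit Types (u v w : 'rV[R]_n) (k : R).

Lemma dotC u v : dot u v = dot v u.
Proof. by apply: eq_bigr => i _; rewrite mulrC. Qed.

Lemma dotDl u v w : dot (u + v) w = dot u w + dot v w.
Proof. by rewrite -big_split; apply: eq_bigr => i _; rewrite mxE mulrDl. Qed.

Lemma dotZl k u v : dot (k *: u) v = k * dot u v.
Proof. by rewrite mulr_sumr; apply: eq_bigr => i _; rewrite mxE mulrA. Qed.

Lemma dotNl u v : dot (- u) v = - dot u v.
Proof. by rewrite -scaleN1r dotZl mulN1r. Qed.

Lemma dotBl u v w : dot (u - v) w = dot u w - dot v w.
Proof. by rewrite dotDl dotNl. Qed.

Lemma dotZr k u v : dot u (k *: v) = k * dot u v.
Proof. by rewrite dotC dotZl dotC. Qed.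

Lemma dotBr u v w : dot u (v - w) = dot u v - dot u w.
Proof. by rewrite dotC dotBl !(dotC u). Qed.

Lemma dot0l u : dot 0 u = 0.
Proof. by rewrite -(scale0r 0) dotZl mul0r. Qed.

Lemma dot_suml (I : Type) (r : seq I) (P : pred I) (F : I -> 'rV[R]_n) u :
  dot (\sum_(i <- r | P i) F i) u = \sum_(i <- r | P i) dot (F i) u.
Proof.
by apply: (big_morph (fun w => dot w u)) => [v w|]; rewrite ?dotDl ?dot0l.
Qed.

Lemma dot_ge0 u : 0 <= dot u u.
Proof. by apply: sumr_ge0 => i _; rewrite -expr2 sqr_ge0. Qed.

Lemma norm2_ge0 u : 0 <= norm2 u.
Proof. exact: sqrtr_ge0. Qed.

Lemma norm2_sqr u : norm2 u ^+ 2 = dot u u.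
Proof. by rewrite sqr_sqrtr ?dot_ge0. Qed.

Lemma norm2Z k u : norm2 (k *: u) = `|k| * norm2 u.
Proof.
by rewrite /norm2 dotZl dotZr mulrA -expr2 sqrtrM ?sqr_ge0// sqrtr_sqr.
Qed.

Lemma norm2_eq0 u : norm2 u = 0 -> u = 0.
Proof.
move=> u0; have : dot u u == 0 by rewrite -norm2_sqr u0 expr0n.
rewrite psumr_eq0 => [/allP uu0|i _]; last by rewrite -expr2 sqr_ge0.
apply/rowP => i; rewrite mxE; apply/eqP; rewrite -sqrf_eq0 expr2.
exact: uu0 (mem_index_enum i).
Qed.

Lemma dot_le_norm2 u v : dot u v <= norm2 u * norm2 v.
Proof.
have [u0|u0] := eqVneq (norm2 u) 0.
  by rewrite u0 mul0r (norm2_eq0 u0) dot0l.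
have [v0|v0] := eqVneq (norm2 v) 0.
  by rewrite v0 mulr0 (norm2_eq0 v0) dotC dot0l.
have uv_gt0 : 0 < norm2 u * norm2 v.
  by rewrite mulr_gt0 ?lt0r ?u0 ?v0 ?norm2_ge0.
(* the square of the norm of |v| u - |u| v is 2 |u| |v| (|u| |v| - <u, v>) *)
have := dot_ge0 (norm2 v *: u - norm2 u *: v).
rewrite dotBl !dotZl !dotBr !dotZr (dotC v u) -!norm2_sqr => h.
rewrite -(ler_pM2l uv_gt0); lra.
Qed.

End InnerProduct.

(** * Segments of the cube and convexity *)

Section Segments.
Context {R : realType} {n : nat}.
Implicit Types (a b : 'rV[R]_n) (t : R).

Lemma cube_segment a b t : cube a -> cube b -> 0 <= t <= 1 ->
  cube (a + t *: (b - a)).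
Proof.
move=> ca cb /andP[t0 t1] i; move: (ca i) (cb i) => /andP[? ?] /andP[? ?].
rewrite !mxE; apply/andP; split; nra.
Qed.

Lemma cube_scale a t : cube a -> 0 <= t <= 1 -> cube (t *: a).
Proof.
move=> ca /andP[t0 t1] i; move: (ca i) => /andP[? ?].
rewrite !mxE; apply/andP; split; nra.
Qed.

Lemma vle_scale a t t' : cube a -> t <= t' -> vle (t *: a) (t' *: a).
Proof.
by move=> ca tt' i; rewrite !mxE ler_wpM2r//; have /andP[] := ca i.
Qed.

Lemma convex_comb (P : set 'rV[R]_n) a b t : convex_set P -> 0 <= t <= 1 ->
  P a -> P b -> P ((1 - t) *: a + t *: b).
Proof.
move=> cP /andP[t0 t1] Pa Pb.
have t01 : 0 <= 1 - t <= 1 by apply/andP; split; lra.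
pose s : {i01 R} := Itv01 (proj1 (andP t01)) (proj2 (andP t01)).
have := cP a b s; rewrite !inE => /(_ Pa Pb).
suff -> : conv s (a : convex_lmodType _) b = (1 - t) *: a + t *: b by [].
by rewrite /conv/= /unstable.onem/= subKr.
Qed.

Lemma iterates_in_body (P : set 'rV[R]_n) (t : R) (k : nat)
    (y s : nat -> 'rV[R]_n) :
  convex_set P -> 0 <= t <= 1 -> P (y 0%N) ->
  (forall i, (i < k)%N -> P (s i)) ->
  (forall i, (i < k)%N -> y i.+1 = (1 - t) *: y i + t *: s i) ->
  forall i, (i <= k)%N -> P (y i).
Proof.
move=> cP t01 Py0 Ps yS; elim=> [//|i IHi ik]; rewrite yS//.
by apply: convex_comb => //; [exact/IHi/ltnW|exact: Ps].
Qed.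

Lemma concave_segment (f : 'rV[R]_n -> R) a b t : concave f ->
  cube a -> cube b -> 0 <= t <= 1 ->
  t * (f b - f a) <= f (a + t *: (b - a)) - f a.
Proof.
move=> cf ca cb /andP[t0 t1].
pose s : {i01 R} := Itv01 t0 t1.
have := cf s b a; rewrite !inE => /(_ cb ca).
rewrite convRE.
have -> : conv s (b : convex_lmodType _) a = a + t *: (b - a).
  rewrite /conv/= /unstable.onem/= scalerBl scale1r scalerBr.
  by rewrite addrCA.
rewrite /unstable.onem/=; lra.
Qed.

End Segments.

(** * Gradients relative to the cube *)

Section Gradients.
Context {R : realType} {n : nat}.
Implicit Types (f : 'rV[R]_n -> R) (a b g : 'rV[R]_n).

(** The norm of the space of rows is the sup norm, so its balls bound each
    coordinate separately. *)
Lemma is_gradientP f a g : is_gradient f a g <->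
  forall eta : R, 0 < eta -> exists2 delta : R, 0 < delta &
    forall b, cube b -> (forall i, `|b 0 i - a 0 i| < delta) ->
      `|f b - f a - dot g (b - a)| <= eta * norm2 (b - a).
Proof.
split=> fg eta eta0.
- move: (fg eta eta0); rewrite near_withinE => /nbhs_ballP[delta /= d0 fd].
  exists delta => // b cb ab; apply: fd => //; split=> // i j.
  by rewrite (ord1 i) /ball/= distrC.
- have [delta d0 fd] := fg eta eta0.
  rewrite near_withinE; apply/nbhs_ballP; exists delta => //= b [_ ab] cb.
  by apply: fd => // i; have := ab 0 i; rewrite /ball/= distrC.
Qed.

Lemma is_gradientD f1 f2 a g1 g2 : is_gradient f1 a g1 -> is_gradient f2 a g2 ->
  is_gradient (fun x => f1 x + f2 x) a (g1 + g2).
Proof.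
move=> fg1 fg2 eta eta0; have e0 : 0 < eta / 2 by rewrite divr_gt0.
move: (fg1 _ e0) (fg2 _ e0); apply: filterS2 => b h1 h2.
rewrite dotDl (splitr eta) mulrDl; apply: le_trans (lerD h1 h2).
by apply: le_trans (ler_normD _ _); rewrite le_eqVlt; apply/orP; left;
  apply/eqP; congr (`| _ |); ring.
Qed.

Lemma is_gradientZ k f a g : is_gradient f a g ->
  is_gradient (fun x => k * f x) a (k *: g).
Proof.
move=> fg eta eta0; have k0 : 0 < `|k| + 1 by rewrite ltr_wpDl.
have e0 : 0 < eta / (`|k| + 1) by rewrite divr_gt0.
move: (fg _ e0); apply: filterS => b h.
rewrite dotZl -!mulrBr normrM.
apply: (@le_trans _ _ ((`|k| + 1) * (eta / (`|k| + 1) * norm2 (b - a)))).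
  by apply: ler_pM => //; lra.
by rewrite mulrA mulrCA divff ?mulr1// gt_eqF.
Qed.

Lemma is_gradient0 a : is_gradient (fun=> 0) a 0.
Proof.
move=> eta eta0; near=> b.
by rewrite dot0l !subr0 normr0 mulr_ge0 ?norm2_ge0// ltW.
Unshelve. all: by end_near.
Qed.

Lemma is_gradient_sum (I : eqType) (r : seq I) (F : I -> 'rV[R]_n -> R)
    (g : I -> 'rV[R]_n) a : (forall i, i \in r -> is_gradient (F i) a (g i)) ->
  is_gradient (fun x => \sum_(i <- r) F i x) a (\sum_(i <- r) g i).
Proof.
elim: r => [|i r IHr] Fg.
  rewrite big_nil (_ : (fun x => _) = fun=> 0); first exact: is_gradient0.
  by apply/funext => x; rewrite big_nil.
rewrite big_cons (_ : (fun x => _) = fun x => F i x + \sum_(j <- r) F j x).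
  apply: is_gradientD; first by apply: Fg; rewrite mem_head.
  by apply: IHr => j jr; apply: Fg; rewrite in_cons jr orbT.
by apply/funext => x; rewrite big_cons.
Qed.

(** Chain rule for a homothety of the cube into itself. *)
Lemma is_gradient_scale f a g t : 0 <= t <= 1 ->
  is_gradient f (t *: a) g -> is_gradient (fun x => f (t *: x)) a (t *: g).
Proof.
move=> t01 /is_gradientP fg; apply/is_gradientP => eta eta0.
have [delta d0 fd] := fg eta eta0; exists delta => // b cb ab.
have /andP[t0 t1] := t01.
rewrite dotZl -dotZr scalerBr; apply: le_trans (fd _ _ _) _.
- exact: cube_scale.
- move=> i; rewrite !mxE -mulrBr normrM (ger0_norm t0).
  by apply: le_lt_trans (ab i); rewrite ler_piMl.
- by rewrite -scalerBr norm2Z ger0_norm// ler_wpM2l ?(ltW eta0)// ler_piMl ?norm2_ge0.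
Qed.

(** Restricted to a segment of the cube, [f] is differentiable at [t] with
    derivative [dot g (b - a)]; the estimate is one-sided at the endpoints, where
    only [s] in [0, 1] is allowed. *)
Lemma gradient_segment f a b g t : cube a -> cube b -> 0 <= t <= 1 ->
  is_gradient f (a + t *: (b - a)) g ->
  forall eta : R, 0 < eta -> exists2 delta : R, 0 < delta &
    forall s : R, 0 <= s <= 1 -> `|s - t| < delta ->
      `|f (a + s *: (b - a)) - f (a + t *: (b - a)) - (s - t) * dot g (b - a)|
        <= eta * `|s - t|.
Proof.
move=> ca cb t01 /is_gradientP fg eta eta0; set d := b - a.
have d0 : 0 < norm2 d + 1 by rewrite ltr_wpDl ?norm2_ge0.
have [|delta delta0 fd] := fg (eta / (norm2 d + 1)); first exact: divr_gt0.
exists delta => // s s01 st.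
have -> : a + s *: d = a + t *: d + (s - t) *: d.
  by rewrite -addrA -scalerDl subrKC.
have := fd (a + t *: d + (s - t) *: d).
rewrite [_ + _ - (a + _)]addrC addKr dotZr norm2Z => h.
apply: le_trans (h _ _) _.
- by rewrite -addrA -scalerDl subrKC; exact: cube_segment.
- move=> i; rewrite !mxE [X in `|X|](_ : _ = (s - t) * (b 0 i - a 0 i)); last ring.
  rewrite normrM; apply: le_lt_trans st; rewrite ler_piMr//.
  move: (ca i) (cb i) => /andP[? ?] /andP[? ?].
  by rewrite ler_norml; apply/andP; split; lra.
- rewrite mulrCA [leRHS]mulrC ler_wpM2l// -mulrA ler_piMr ?(ltW eta0)//.
  by rewrite mulrC ler_pdivrMr// mul1r lerDl.
Qed.

(** A lower bound on the difference quotients at [a + (b - a) / N] passes to the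
    directional derivative; sequences suffice, which is what both concavity and
    subdivision of a segment provide. *)
Lemma gradient_ge f a b g c : cube a -> cube b -> is_gradient f a g ->
  (forall N : nat, c <= N.+1%:R * (f (a + N.+1%:R^-1 *: (b - a)) - f a)) ->
  c <= dot g (b - a).
Proof.
move=> ca cb fg fc; apply/ler_addgt0Pr => eta eta0.
have fg0 : is_gradient f (a + 0 *: (b - a)) g by rewrite scale0r addr0.
have t01 : 0 <= (0 : R) <= 1 by rewrite lexx ler01.
have [delta d0 fd] := gradient_segment ca cb t01 fg0 eta0.
pose N := Num.truncn delta^-1.
have N0 : (0 : R) < N.+1%:R by rewrite ltr0n.
have i0 : (0 : R) < N.+1%:R^-1 by rewrite invr_gt0.
have s01 : 0 <= (N.+1%:R^-1 : R) <= 1.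
  by rewrite (ltW i0) invf_le1// ler1n.
have sd : `|N.+1%:R^-1 - 0| < delta.
  rewrite subr0 gtr0_norm// invf_plt ?posrE//.
  exact: truncnS_gt.
have := fd _ s01 sd.
rewrite scale0r addr0 subr0 (gtr0_norm i0) => /(le_trans (ler_norm _)) h.
apply: le_trans (fc N) _.
by rewrite -(ler_pM2l i0) mulrA mulVf ?gt_eqF// mul1r mulrDr -lerBlDl (mulrC _ eta).
Qed.

Lemma gradient_le f a b g c : cube a -> cube b -> is_gradient f a g ->
  (forall N : nat, N.+1%:R * (f (a + N.+1%:R^-1 *: (b - a)) - f a) <= c) ->
  dot g (b - a) <= c.
Proof.
move=> ca cb fg fc; rewrite -lerN2 -dotNl -(scaleN1r g).
apply: (gradient_ge ca cb (is_gradientZ (-1) fg)) => N.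
by rewrite -mulrBr mulN1r mulrN lerN2.
Qed.

(** Two gradients agree along every segment issued from [a], and each coordinate
    direction at [a] is spanned by such a segment. *)
Lemma is_gradient_unique f a g g' : cube a ->
  is_gradient f a g -> is_gradient f a g' -> g = g'.
Proof.
move=> ca fg fg'.
have fz : is_gradient (fun=> 0) a (g - g').
  have := is_gradientD fg (is_gradientZ (-1) fg').
  rewrite scaleN1r; congr (is_gradient _ _ _).
  by apply/funext => x; rewrite mulN1r subrr.
have z b : cube b -> dot (g - g') (b - a) = 0.
  move=> cb; apply/eqP; rewrite eq_le; apply/andP; split.
  - by apply: (gradient_le ca cb fz) => N; rewrite subrr mulr0.
  - by apply: (gradient_ge ca cb fz) => N; rewrite subrr mulr0.
apply/rowP => i; apply/eqP; rewrite -subr_eq0.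
(* move the i-th coordinate to whichever of 0 and 1 differs from it *)
pose v : R := (a 0 i == 0)%:R.
pose b := \row_j (if j == i then v else a 0 j).
have cb : cube b.
  by move=> j; rewrite mxE; case: ifP => // _; rewrite /v ler0n lern1 leq_b1.
have := z _ cb; rewrite /dot (bigD1 i)//= big1 => [|j ji]; last first.
  by rewrite !mxE (negPf ji) subrr mulr0.
rewrite !mxE eqxx addr0 => /eqP; rewrite mulf_eq0 => /orP[//|].
by rewrite /v; have [->|a0] := eqVneq (a 0 i) 0;
  rewrite ?subr0 ?sub0r ?oppr_eq0 ?oner_eq0// (negPf a0).
Qed.

Lemma gradientE f a g : cube a -> is_gradient f a g -> gradient f a = g.
Proof.
move=> ca fg; rewrite /gradient; case: xgetP => [x _ fx|/(_ g)//].
exact: is_gradient_unique fx fg.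
Qed.

Lemma is_gradient_gradient f L a : smooth L f -> cube a ->
  is_gradient f a (gradient f a).
Proof.
by move=> [df _] ca; have [g fg] := df _ ca; rewrite (gradientE ca fg).
Qed.

(** The one-variable mean value theorem for the restriction of [f] to the
    segment: it asks for derivatives inside the interval only, where the
    relative estimate is two-sided. *)
Lemma segment_mean_value f (df : 'rV[R]_n -> 'rV[R]_n) a b :
  cube a -> cube b -> (forall x, cube x -> is_gradient f x (df x)) ->
  exists2 t : R, 0 <= t <= 1 &
    f b - f a = dot (df (a + t *: (b - a))) (b - a).
Proof.
move=> ca cb fdf; set d := b - a.
pose h (t : R) := f (a + t *: d).
have seg (t : R) : 0 <= t <= 1 -> forall eta : R, 0 < eta ->
    exists2 delta : R, 0 < delta & forall s : R, 0 <= s <= 1 -> `|s - t| < delta ->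
      `|h s - h t - (s - t) * dot (df (a + t *: d)) d| <= eta * `|s - t|.
  by move=> t01; apply: gradient_segment => //; apply/fdf/cube_segment.
have hd (t : R) : t \in `]0, 1[ -> is_derive t 1 h (dot (df (a + t *: d)) d).
  rewrite in_itv/= => /andP[t0 t1].
  have t01 : 0 <= t <= 1 by rewrite !ltW.
  suff cv : (fun k => k^-1 *: ((h \o shift t) (k *: (1 : R)) - h t)) @ 0^' -->
      dot (df (a + t *: d)) d.
    by apply: DeriveDef; [exact: cvgP cv|exact: cvg_lim cv].
  apply/cvgrPdist_le => eta eta0.
  have [delta d0 hs] := seg t t01 eta eta0.
  apply/nbhs_ballP; exists (Num.min delta (Num.min t (1 - t))) => /=.
    by rewrite !lt_min d0 t0 subr_gt0 t1.
  move=> k; rewrite /ball/= sub0r normrN !lt_min => /and3P[kd kt k1] k0.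
  rewrite /shift/= [_ *: 1]mulr1 -[k^-1 *: _]/(k^-1 * _).
  have ks : 0 <= k + t <= 1.
    by move: kt k1; rewrite !ltr_norml => /andP[? _] /andP[_ ?]; apply/andP; split; lra.
  have := hs _ ks; rewrite addrK => /(_ kd) h1.
  rewrite distrC -[X in _ - X](mulKf k0) -mulrBr normrM normfV.
  by rewrite mulrC ler_pdivrMr ?normr_gt0.
have hc : {within `[0, 1], continuous h}.
  apply/subspace_continuousP => t /=; rewrite in_itv/= => t01.
  apply/cvgrPdist_lt => eta eta0; rewrite near_withinE.
  have [delta d0 hs] := seg t t01 1 ltr01.
  set K := `|dot (df (a + t *: d)) d| + 1.
  have K0 : 0 < K by rewrite ltr_wpDl.
  apply/nbhs_ballP; exists (Num.min delta (eta / K)) => /=.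
    by rewrite lt_min d0 divr_gt0.
  move=> s; rewrite /ball/= distrC lt_min ltr_pdivlMr// => /andP[sd sK].
  rewrite in_itv/= => s01; have := hs s s01 sd; rewrite mul1r => h1.
  rewrite distrC; apply: le_lt_trans sK.
  rewrite -(subrK ((s - t) * dot (df (a + t *: d)) d) (h s - h t)).
  by apply: le_trans (ler_normD _ _) _; rewrite normrM mulrDr mulr1 addrC lerD2l.
have [t t01 ht] := MVT_segment ler01 hd hc.
exists t; first by rewrite in_itv in t01.
have := ht; rewrite subr0 mulr1 /h scale1r scale0r addr0.
by rewrite /d subrKC.
Qed.

End Gradients.

(** * Tangent inequalities for DR-submodular functions *)

Section DRSubmodular.
Context {R : realType} {n : nat} {G : 'rV[R]_n -> R}.
Hypothesis drG : dr_submodular G.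
Implicit Types (a b d g w x y : 'rV[R]_n).

(** Diminishing returns along every nonnegative direction: the increment is
    performed one coordinate at a time. *)
Lemma dr_submodular_shift a b d : cube a -> cube (b + d) -> vle a b -> vle 0 d ->
  G (b + d) - G b <= G (a + d) - G a.
Proof.
move=> ca cbd ab d0.
(* p k keeps the first k coordinates of d *)
pose p k : 'rV[R]_n := \row_i (if (i < k)%N then d 0 i else 0).
have pn : p n = d by apply/rowP => i; rewrite mxE ltn_ord.
have pS (i : 'I_n) : p i.+1 = p i + d 0 i *: delta_mx 0 i.
  apply/rowP => j; rewrite !mxE eqxx/= ltnS leq_eqVlt.
  have [/val_inj->|ji]/= := eqVneq (val j) (val i).
    by rewrite eqxx ltnn add0r mulr1.
  by rewrite (_ : j == i = false) ?mulr0 ?addr0//; apply/negbTE.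
have bnd i : [/\ 0 <= a 0 i, a 0 i <= b 0 i, 0 <= d 0 i & b 0 i + d 0 i <= 1].
  move: (cbd i) (ca i) (ab i) (d0 i); rewrite !mxE.
  by move=> /andP[? ?] /andP[? ?].
have cp k : cube (a + p k) /\ cube (b + p k).
  by split=> i; have [? ? ? ?] := bnd i; rewrite !mxE; case: ifP => _;
    apply/andP; split; lra.
suff H k : (k <= n)%N -> G (b + p k) - G b <= G (a + p k) - G a.
  by have := H n (leqnn n); rewrite pn.
elim: k => [_|k IHk kn].
  have -> : p 0%N = 0 by apply/rowP => i; rewrite !mxE.
  by rewrite !addr0 !subrr.
have pk : p k.+1 = p k + d 0 (Ordinal kn) *: delta_mx 0 (Ordinal kn) := pS (Ordinal kn).
have := IHk (ltnW kn); rewrite pk !addrA.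
have [-> //|dk] := eqVneq (d 0 (Ordinal kn)) 0; first by rewrite !scale0r !addr0.
have dk0 : 0 < d 0 (Ordinal kn) by rewrite lt0r dk; have [] := bnd (Ordinal kn).
have [ca1 cb1] := cp k; have [ca2 cb2] := cp k.+1.
have := @drG (a + p k) (b + p k) _ (Ordinal kn) ca1 cb1 _ dk0.
rewrite -!addrA -pk.
move=> /(_ _ ca2 cb2); 
have abk : vle (a + p k) (b + p k) by move=> i; rewrite !mxE lerD2r; exact: ab.
move=> /(_ abk); lra.
Qed.

Section Segment.
Context {a b : 'rV[R]_n}.
Hypotheses (ca : cube a) (cb : cube b) (ab : vle a b).
Variable N : nat.

Let q (k : nat) : 'rV[R]_n := a + (k%:R / N.+1%:R) *: (b - a).

Let N_gt0 : 0 < N.+1%:R :> R. Proof. by rewrite ltr0n. Qed.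

Let cq k : (k <= N.+1)%N -> cube (q k).
Proof.
move=> kN; apply: cube_segment => //.
by rewrite divr_ge0//= ler_pdivrMr// mul1r ler_nat.
Qed.

Let qS k : q k.+1 = q k + N.+1%:R^-1 *: (b - a).
Proof. by rewrite /q -addrA -scalerDl -natr1 mulrDl mul1r. Qed.

Let sum_q : G b - G a = \sum_(0 <= k < N.+1) (G (q k.+1) - G (q k)).
Proof.
rewrite telescope_sumr// /q divff ?gt_eqF// scale1r mul0r scale0r addr0.
by rewrite subrKC.
Qed.

Let step_ge0 : vle 0 (N.+1%:R^-1 *: (b - a)).
Proof. by move=> i; rewrite !mxE mulr_ge0 ?subr_ge0// invr_ge0 ltW. Qed.

(** Cutting the segment from [a] to [b] into equal steps, diminishing returns
    make the first step the most profitable one, so it beats the average. *)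
Lemma dr_first_step_ge :
  G b - G a <= N.+1%:R * (G (a + N.+1%:R^-1 *: (b - a)) - G a).
Proof.
rewrite sum_q mulr_natl -[X in _ *+ X]subn0 -sumr_const_nat.
apply: ler_sum_nat => k /= kN; rewrite qS.
apply: dr_submodular_shift => //; first by (rewrite -qS; exact: cq).
by move=> i; rewrite !mxE lerDl mulr_ge0 ?subr_ge0.
Qed.

(** Symmetrically, the last step is the least profitable one. *)
Lemma dr_last_step_le :
  N.+1%:R * (G b - G (b + N.+1%:R^-1 *: (a - b))) <= G b - G a.
Proof.
rewrite sum_q mulr_natl -[X in _ *+ X]subn0 -sumr_const_nat.
apply: ler_sum_nat => k /= kN; rewrite qS.
set b' := b + _.
have b'q : b' = q N.
  rewrite /b' -[in X in X + _](subrKC a b) -(opprB b a) scalerN.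
  rewrite -addrA -[X in X - _]scale1r -scalerBl; congr (_ + _ *: _).
  by rewrite -[X in X - _](@divff _ N.+1%:R) ?gt_eqF// -natr1 mulrDl mul1r addrK.
have b'E : b = b' + N.+1%:R^-1 *: (b - a).
  by rewrite b'q -qS /q divff ?gt_eqF// scale1r subrKC.
rewrite [in X in G X - _]b'E b'q; apply: dr_submodular_shift => //.
- exact/cq/ltnW.
- by rewrite -qS; exact: cq.
- move=> i; rewrite !mxE lerD2l ler_wpM2r ?subr_ge0//.
  by rewrite ler_pM2r ?invr_gt0// ler_nat.
Qed.

End Segment.

Lemma dr_gradient_lower a b g : cube a -> cube b -> vle a b ->
  is_gradient G a g -> G b - G a <= dot g (b - a).
Proof.
by move=> ca cb ab Gg; apply: (gradient_ge ca cb Gg) => N; exact: dr_first_step_ge.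
Qed.

Lemma dr_gradient_upper a b g : cube a -> cube b -> vle a b ->
  is_gradient G b g -> dot g (b - a) <= G b - G a.
Proof.
move=> ca cb ab Gg; rewrite -lerN2 -(dotNl g) -(opprB a b) -(opprB (G a)) opprK.
have -> : dot (- g) (- (a - b)) = dot g (a - b).
  by rewrite dotNl -(scaleN1r (a - b)) dotZr mulN1r opprK.
apply: (gradient_ge cb ca Gg) => N.
rewrite -lerN2 -mulrN !opprB; exact: dr_last_step_le.
Qed.

Hypothesis monoG : cube_monotone G.

(** Moving from [a] down to [a - w] stays in the cube, also when [a] lies on its
    upper boundary; this is why [w] is bounded by [a]. *)
Lemma monotone_gradient_ge0 a w g : cube a -> vle 0 w -> vle w a ->
  is_gradient G a g -> 0 <= dot g w.
Proof.
move=> ca w0 wa Gg.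
have cb : cube (a - w).
  move=> i; move: (ca i) (w0 i) (wa i); rewrite !mxE => /andP[? ?] ? ?.
  by apply/andP; split; lra.
have : dot g (a - w - a) <= 0.
  apply: (gradient_le ca cb Gg) => N; rewrite mulr_ge0_le0// subr_le0.
  have s01 : 0 <= (N.+1%:R^-1 : R) <= 1.
    by rewrite invr_ge0 ler0n/= invf_le1 ?ltr0n// ler1n.
  apply: monoG => //; first exact: cube_segment.
  move=> i; have := w0 i; rewrite !mxE addrAC subrr add0r mulrN gerBl => wi.
  by rewrite mulr_ge0// invr_ge0.
by rewrite addrAC subrr add0r -scaleN1r dotZr mulN1r oppr_le0.
Qed.

(** Comparison with an arbitrary target [y]: the gain from [x] to the
    coordinatewise maximum of [x] and [y] is bounded by the gradient, and [y]
    exceeds that increment by the coordinatewise minimum, on which the gradient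
    of a monotone function is nonnegative. *)
Lemma dr_gradient_target x y g : cube x -> cube y -> is_gradient G x g ->
  G y - G x <= dot g y.
Proof.
move=> cx cy Gg.
pose j : 'rV[R]_n := \row_i Num.max (x 0 i) (y 0 i).
have cj : cube j by move=> i; rewrite mxE; case: (leP (x 0 i)) => _.
have xj : vle x j by move=> i; rewrite mxE le_max lexx.
have yj : vle y j by move=> i; rewrite mxE le_max lexx orbT.
have w0 : 0 <= dot g (y - (j - x)).
  apply: (monotone_gradient_ge0 cx) Gg => i; rewrite !mxE;
    by move: (cx i) (cy i) => /andP[? ?] /andP[? ?]; case: (leP (x 0 i)) => ?; lra.
have := dr_gradient_lower cx cj xj Gg; have := monoG cy cj yj.
by move: w0; rewrite dotBr; lra.
Qed.

End DRSubmodular.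

(** * The auxiliary function *)

(** [1 / (m + 1) <= ln (m + 1) - ln m], from [ln (1 + x) <= x]. *)
Lemma harmonic_le_ln {R : realType} (m : nat) : (0 < m)%N ->
  \sum_(1 <= j < m.+1) (j%:R^-1 : R) <= 1 + ln m%:R.
Proof.
elim: m => [//|[_ _|m IHm _]]; first by rewrite big_nat1 invr1 ln1 addr0.
rewrite big_nat_recr//=; have /= IH := IHm isT.
apply: le_trans (lerD IH (lexx _)) _; rewrite -addrA lerD2l -lerBrDl.
set p : R := m.+1%:R; set q : R := m.+2%:R.
have p0 : 0 < p by rewrite ltr0n.
have q0 : 0 < q by rewrite ltr0n.
have qp : q = p + 1 by rewrite /q -natr1.
rewrite -lerN2 opprB -ln_div ?posrE//.
have -> : p / q = 1 + (- q^-1) by rewrite qp; field; rewrite gt_eqF// addr_gt0.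
by apply: le_ln1Dx; rewrite ltrN2 invf_lt1// qp ltrDr.
Qed.

(** The gradient of [barG] at the step size [1 / m], as given by the chain rule:
    the factor [eps j] of the homothety cancels the one in the denominator. *)
Definition barG_grad {R : realType} {n : nat} (m : nat) (G : 'rV[R]_n -> R)
    (x : 'rV[R]_n) : 'rV[R]_n :=
  m%:R^-1 *: \sum_(1 <= j < m.+1)
    expR (m%:R^-1 * j%:R) *: gradient G ((m%:R^-1 * j%:R) *: x).

Section Auxiliary.
Context {R : realType} {n : nat} {G : 'rV[R]_n -> R} {L : R} {m : nat}.
Hypotheses (m_gt0 : (0 < m)%N) (smoothG : smooth L G).
Let eps : R := m%:R^-1.
Implicit Types (x y a b v : 'rV[R]_n).

Let mr_gt0 : 0 < m%:R :> R. Proof. by rewrite ltr0n. Qed.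
Let eps_gt0 : 0 < eps. Proof. by rewrite invr_gt0. Qed.
Let eps_m : eps * m%:R = 1. Proof. by rewrite mulVf ?gt_eqF. Qed.

Let step01 j : (j <= m)%N -> 0 <= eps * j%:R <= 1.
Proof. by move=> jm; rewrite mulr_ge0 ?(ltW eps_gt0)//= -[leRHS]eps_m ler_pM2l// ler_nat. Qed.

Let stepS j : eps * j.+1%:R = eps * j%:R + eps.
Proof. by rewrite -natr1 mulrDr mulr1. Qed.

Lemma barG_invn x : barG eps G x = eps * \sum_(1 <= j < m.+1)
  (expR (eps * j%:R) * G ((eps * j%:R) *: x) / (eps * j%:R)).
Proof. by rewrite /barG /eps invrK natrK. Qed.

Lemma barG_is_gradient x : cube x ->
  is_gradient (barG eps G) x (barG_grad m G x).
Proof.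
move=> cx; rewrite (funext barG_invn).
apply/is_gradientZ/is_gradient_sum => j; rewrite mem_index_iota ltnS => /andP[j0 jm].
set t := eps * j%:R; have t01 : 0 <= t <= 1 by exact: step01.
have t0 : t != 0 by rewrite gt_eqF// mulr_gt0// ltr0n.
have := is_gradientZ (expR t / t) (is_gradient_scale t01
  (is_gradient_gradient smoothG (cube_scale cx t01))).
rewrite scalerA divfK//; congr (is_gradient _ _ _).
by apply/funext => z; rewrite mulrAC.
Qed.

(** The weights [e^(eps j) * (eps j)] are at most [e], and the average of [m] of
    them is taken. *)
Lemma barG_grad_lipschitz a b v : 0 <= L -> cube a -> cube b ->
  dot (barG_grad m G a - barG_grad m G b) v
    <= expR 1 * L * (norm2 (a - b) * norm2 v).
Proof.
move=> L0 ca cb; rewrite /barG_grad -/eps -scalerBr dotZl -sumrB dot_suml.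
set K := expR 1 * L * _.
have -> : K = eps * \sum_(1 <= j < m.+1) K.
  by rewrite sumr_const_nat subSS subn0 -mulr_natl mulrA eps_m mul1r.
rewrite ler_pM2l//; apply: ler_sum_nat => j /andP[j0]; rewrite ltnS => jm.
set t := eps * j%:R; have t01 : 0 <= t <= 1 by exact: step01.
have /andP[t0 t1] := t01.
have vn := norm2_ge0 v; have abn := norm2_ge0 (a - b).
have lip : dot (gradient G (t *: a) - gradient G (t *: b)) v
    <= L * (norm2 (a - b) * norm2 v).
  apply: le_trans (dot_le_norm2 _ _) _; rewrite mulrA ler_wpM2r//.
  apply: le_trans (smoothG.2 _ _ (cube_scale ca t01) (cube_scale cb t01)) _.
  by rewrite -scalerBr norm2Z ger0_norm// ler_wpM2l// ler_piMl.
rewrite -scalerBr dotZl /K -mulrA.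
apply: le_trans (ler_wpM2l (expR_ge0 t) lip) _.
by rewrite ler_wpM2r ?ler_expR// !mulr_ge0.
Qed.

(** The weights [e^(eps j)] make the estimate telescope: with
    [u_j = G (eps j x)], concavity of [G] on the ray through [x] bounds
    [eps * dot (gradient of G at eps j x) x] by [u_j - u_(j-1)], and the
    j-th term dominates an increment of
    [e^(eps j) G y - (1 + eps) e^(eps j) u_j] because
    [(1 + eps) e^(eps (j-1)) <= e^(eps j)] and
    [(1 - eps) e^(eps j) <= e^(eps (j-1))]. *)
Lemma barG_progress x y : nonnegative G -> cube_monotone G -> dr_submodular G ->
  cube x -> cube y ->
  (expR 1 - 1) * G y - (1 + eps) * (expR 1 * G x)
    <= dot (barG_grad m G x) (y - x).
Proof.
move=> nnG monoG drG cx cy.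
pose u j := G ((eps * j%:R) *: x).
pose phi j : R := expR (eps * j%:R) * G y - (1 + eps) * (expR (eps * j%:R) * u j).
have cu j : (j <= m)%N -> cube ((eps * j%:R) *: x).
  by move=> jm; exact: cube_scale (step01 jm).
have : \sum_(0 <= j < m) (phi j.+1 - phi j) <= dot (barG_grad m G x) (y - x).
  rewrite /barG_grad -/eps dotZl big_add1/= dot_suml mulr_sumr.
  apply: ler_sum_nat => j /andP[_ jm].
  rewrite dotZl dotBr.
  set g := gradient _ _.
  have Gg : is_gradient G ((eps * j.+1%:R) *: x) g.
    exact: is_gradient_gradient smoothG (cu _ jm).
  have target : G y - u j.+1 <= dot g y.
    exact: dr_gradient_target (cu _ jm) cy Gg.
  have ray : eps * dot g x <= u j.+1 - u j.
    rewrite -dotZr (_ : eps *: x = (eps * j.+1%:R) *: x - (eps * j%:R) *: x).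
      apply: dr_gradient_upper Gg => //; [exact/cu/ltnW|exact: cu|].
      by apply: vle_scale => //; rewrite stepS lerDl ltW.
    by rewrite stepS scalerDl addrAC subrr add0r.
  have uj0 : 0 <= u j by exact/nnG/cu/ltnW.
  have y0 : 0 <= G y by exact: nnG.
  have up : (1 + eps) * expR (eps * j%:R) <= expR (eps * j.+1%:R).
    by rewrite stepS expRD mulrC ler_wpM2l ?expR_ge0// expR_ge1Dx.
  have down : (1 - eps) * expR (eps * j.+1%:R) <= expR (eps * j%:R).
    have -> : eps * j%:R = eps * j.+1%:R + (- eps) by rewrite stepS addrK.
    by rewrite [in leRHS]expRD mulrC ler_wpM2l ?expR_ge0// expR_ge1Dx.
  rewrite /phi; move: up down (expR_gt0 (eps * j.+1%:R)).
  move: (expR (eps * j.+1%:R)) (expR (eps * j%:R)) => E' E up down E'0.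
  have h1 := ler_wpM2r uj0 up; have h2 := ler_wpM2r y0 down.
  have h3 : eps * E' * (G y - u j.+1) <= eps * E' * dot g y.
    by rewrite ler_pM2l// mulr_gt0.
  have h4 : E' * (eps * dot g x) <= E' * (u j.+1 - u j) by rewrite ler_pM2l.
  lra.
rewrite telescope_sumr// /phi eps_m mulr0 expR0 /u eps_m scale1r mulr0 scale0r.
have : 0 <= (1 + eps) * (1 * G (0 : 'rV[R]_n)).
  rewrite mul1r mulr_ge0 ?addr_ge0 ?(ltW eps_gt0)//; apply: nnG => i.
  by rewrite mxE lexx ler01.
lra.
Qed.

Lemma barG_ge0 x : nonnegative G -> cube x -> 0 <= barG eps G x.
Proof.
move=> nnG cx; rewrite barG_invn mulr_ge0 ?(ltW eps_gt0)//.
rewrite big_nat; apply: sumr_ge0 => j; rewrite ltnS => /andP[_ jm].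
have jm01 := step01 jm; have /andP[j0 _] := jm01.
rewrite divr_ge0// mulr_ge0 ?expR_ge0//; exact/nnG/cube_scale.
Qed.

(** By monotonicity each [G (eps j x)] is at most [G x], and the remaining sum
    of [1 / j] is the harmonic number of [m = 1 / eps]. *)
Lemma barG_le x : nonnegative G -> cube_monotone G -> cube x ->
  barG eps G x <= fw_beta eps * G x.
Proof.
move=> nnG monoG cx; rewrite barG_invn.
have Gx := nnG _ cx; have e0 := expR_ge0 (1 : R).
apply: (@le_trans _ _ (expR 1 * G x * \sum_(1 <= j < m.+1) j%:R^-1)); last first.
  rewrite /fw_beta /eps lnV ?posrE// opprK mulrAC ler_wpM2r// ler_wpM2l//.
  exact: harmonic_le_ln.
rewrite !mulr_sumr; apply: ler_sum_nat => j; rewrite ltnS => /andP[j0 jm].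
have jr0 : 0 < j%:R :> R by rewrite ltr0n.
have j01 := step01 jm; have /andP[t0 t1] := j01.
have -> : eps * (expR (eps * j%:R) * G ((eps * j%:R) *: x) / (eps * j%:R))
    = expR (eps * j%:R) * G ((eps * j%:R) *: x) / j%:R.
  by field; rewrite !gt_eqF.
rewrite ler_pM2r ?invr_gt0//; apply: ler_pM.
- exact: expR_ge0.
- exact/nnG/cube_scale.
- by rewrite ler_expR.
- apply: monoG => //; first exact: cube_scale.
  by rewrite -[X in vle _ X]scale1r; exact: vle_scale.
Qed.

End Auxiliary.

(** * The approximation guarantee *)

(** A step towards [b] loses at most a quadratic term: the increment is a
    gradient at some intermediate point, which differs from the gradient at [a]
    by at most [K * t * norm2 (b - a)]. *)
Lemma lipschitz_gradient_step {R : realType} {n : nat} (f : 'rV[R]_n -> R)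
    (df : 'rV[R]_n -> 'rV[R]_n) (K t : R) (a b : 'rV[R]_n) :
  (forall x, cube x -> is_gradient f x (df x)) ->
  (forall x y v, cube x -> cube y ->
     dot (df x - df y) v <= K * (norm2 (x - y) * norm2 v)) ->
  0 <= K -> 0 <= t <= 1 -> cube a -> cube b ->
  t * dot (df a) (b - a) - K * t ^+ 2 * norm2 (b - a) ^+ 2
    <= f (a + t *: (b - a)) - f a.
Proof.
move=> fdf lip K0 t01 ca cb; have /andP[t0 t1] := t01.
set d := b - a; set c := a + t *: d.
have cc : cube c by exact: cube_segment.
have cad : c - a = t *: d by rewrite /c addrAC subrr add0r.
have [s /andP[s0 s1] ->] := segment_mean_value ca cc fdf.
rewrite cad dotZr; set z := a + s *: (t *: d).
have cz : cube z by rewrite /z scalerA; apply: cube_segment => //; nra.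
have := lip a z d ca cz.
have -> : a - z = (- (s * t)) *: d.
  by rewrite /z scalerA opprD addrA subrr add0r scaleNr.
rewrite norm2Z normrN ger0_norm ?mulr_ge0// dotBl => h.
have N0 : 0 <= K * norm2 d ^+ 2 by rewrite mulr_ge0// sqr_ge0.
have h1 : t * (dot (df a) d - dot (df z) d) 
    <= t * (K * (s * t * norm2 d * norm2 d)).
  exact: ler_wpM2l.
have h2 : (K * norm2 d ^+ 2) * (s * t ^+ 2) <= (K * norm2 d ^+ 2) * t ^+ 2.
  by apply: ler_wpM2l => //; rewrite ler_piMl// sqr_ge0.
lra.
Qed.

(** Vectors of the cube have nonnegative inner product, which saves a factor two
    over the triangle inequality. *)
Lemma norm2_diff_le {R : realType} {n : nat} (D : R) (a b : 'rV[R]_n) :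
  cube a -> cube b -> norm2 a <= D -> norm2 b <= D ->
  norm2 (b - a) ^+ 2 <= 2 * D ^+ 2.
Proof.
move=> ca cb aD bD; have a0 := norm2_ge0 a; have b0 := norm2_ge0 b.
have ab0 : 0 <= dot a b.
  apply: sumr_ge0 => i _; move: (ca i) (cb i) => /andP[? _] /andP[? _].
  exact: mulr_ge0.
rewrite norm2_sqr dotBl !dotBr (dotC b a) -!norm2_sqr; nra.
Qed.

(** The cube has two distinct points, at which the Lipschitz bound forces the
    sign of [L]. *)
Lemma smooth_ge0 {R : realType} {n : nat} (L : R) (f : 'rV[R]_n -> R) :
  (0 < n)%N -> smooth L f -> 0 <= L.
Proof.
move=> n0 [_ lip].
have c1 : cube (const_mx 1 : 'rV[R]_n) by move=> i; rewrite mxE ler01 lexx.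
have c0 : cube (0 : 'rV[R]_n) by move=> i; rewrite mxE lexx ler01.
have N0 : 0 < norm2 (const_mx 1 - 0 : 'rV[R]_n).
  rewrite lt0r norm2_ge0 andbT; apply/eqP => /norm2_eq0/rowP/(_ (Ordinal n0)).
  by rewrite !mxE subr0 => /eqP; rewrite oner_eq0.
by have := le_trans (norm2_ge0 _) (lip _ _ c1 c0); rewrite pmulr_lge0.
Qed.

Definition fw_potential {R : realType} {n : nat} (m : nat)
    (G C : 'rV[R]_n -> R) (x : 'rV[R]_n) : R :=
  (expR 1)^-1 * barG m%:R^-1 G x + C x.

Definition fw_direction {R : realType} {n : nat} (m : nat)
    (G C : 'rV[R]_n -> R) (x : 'rV[R]_n) : 'rV[R]_n :=
  (expR 1)^-1 *: barG_grad m G x + gradient C x.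

(** The first [k] iterations, with the formula that the program evaluates in
    place of the gradient of [barG]; [frank_wolfeP] identifies the two. *)
Definition trajectory {R : realType} {n : nat} (P : set 'rV[R]_n) (m : nat)
    (G C : 'rV[R]_n -> R) (k : nat) (y s : nat -> 'rV[R]_n) : Prop :=
  [/\ P (y 0%N),
     forall i, (i < k)%N -> argmax P (dot (fw_direction m G C (y i))) (s i) &
     forall i, (i < k)%N -> y i.+1 = (1 - m%:R^-1) *: y i + m%:R^-1 *: s i].

Lemma trajectory_in_body {R : realType} {n : nat} (P : set 'rV[R]_n) (m : nat)
    (G C : 'rV[R]_n -> R) (k : nat) (y s : nat -> 'rV[R]_n) :
  (0 < m)%N -> convex_set P -> trajectory P m G C k y s ->
  forall i, (i <= k)%N -> P (y i).
Proof.
move=> m0 cP [Py0 smax yS]; apply: iterates_in_body cP _ Py0 _ yS.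
  by rewrite invr_ge0 ler0n/= invf_le1 ?ltr0n// ler1n.
by move=> i /smax[].
Qed.

Section Guarantee.
Context {R : realType} {n : nat} {P : set 'rV[R]_n} {G C : 'rV[R]_n -> R}
  {L D : R} {o : 'rV[R]_n} {m : nat}.
Let eps : R := m%:R^-1.
Hypotheses (n_gt0 : (0 < n)%N) (m_gt0 : (0 < m)%N).
Hypotheses (bodyP : convex_body P) (Pcube : P `<=` cube).
Hypotheses (nnG : nonnegative G) (monoG : cube_monotone G)
  (smoothG : smooth L G) (drG : dr_submodular G).
Hypotheses (nnC : nonnegative C) (smoothC : smooth L C) (concC : concave C).
Hypotheses (oP : argmax P (G \+ C) o).
Hypothesis (normP : forall x, P x -> norm2 x <= D).

Let phi := fw_potential m G C.
Let dphi := fw_direction m G C.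

Let e_gt0 : 0 < expR 1 :> R. Proof. exact: expR_gt0. Qed.
Let mr_gt0 : 0 < m%:R :> R. Proof. by rewrite ltr0n. Qed.
Let eps_gt0 : 0 < eps. Proof. by rewrite invr_gt0. Qed.
Let eps_le1 : eps <= 1. Proof. by rewrite invf_le1// ler1n. Qed.
Let L_ge0 : 0 <= L. Proof. exact: smooth_ge0 smoothG. Qed.

Let phi_gradient x : cube x -> is_gradient phi x (dphi x).
Proof.
move=> cx; apply: is_gradientD; last exact: is_gradient_gradient smoothC cx.
by apply/is_gradientZ/barG_is_gradient => //; exact: smoothG.
Qed.

Let dphi_lipschitz x y v : cube x -> cube y ->
  dot (dphi x - dphi y) v <= 2 * L * (norm2 (x - y) * norm2 v).
Proof.
move=> cx cy.
have h1 := barG_grad_lipschitz m_gt0 smoothG v L_ge0 cx cy.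
have h2 : dot (gradient C x - gradient C y) v <= L * (norm2 (x - y) * norm2 v).
  apply: le_trans (dot_le_norm2 _ _) _; rewrite mulrA ler_wpM2r ?norm2_ge0//.
  exact: smoothC.2.
rewrite /dphi /fw_direction opprD addrACA -scalerBr dotDl dotZl.
have : (expR 1)^-1 * dot (barG_grad m G x - barG_grad m G y) v
    <= L * (norm2 (x - y) * norm2 v).
  by rewrite mulrC ler_pdivrMr//; lra.
lra.
Qed.

(** Every iteration increases [phi] by [eps] times the current gap to the
    target value, up to a quadratic error. *)
Lemma phi_step y s : P y -> argmax P (dot (dphi y)) s ->
  eps * ((1 - (expR 1)^-1) * G o + C o - (1 + eps) * G y - C y
         - 4 * eps * L * D ^+ 2)
    <= phi ((1 - eps) *: y + eps *: s) - phi y.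
Proof.
move=> Py [Ps smax]; have [Po _] := oP.
have cy := Pcube Py; have cs := Pcube Ps; have co := Pcube Po.
have e01 : 0 <= eps <= 1 by rewrite ltW.
have -> : (1 - eps) *: y + eps *: s = y + eps *: (s - y).
  by rewrite scalerBl scale1r scalerBr addrAC addrA.
have K0 : 0 <= 2 * L by rewrite mulr_ge0.
have := lipschitz_gradient_step phi_gradient dphi_lipschitz K0 e01 cy cs.
have : L * norm2 (s - y) ^+ 2 <= L * (2 * D ^+ 2).
  by apply: ler_wpM2l => //; apply: norm2_diff_le => //; exact: normP.
have Cgap : C o - C y <= dot (gradient C y) (o - y).
  apply: (gradient_ge cy co (is_gradient_gradient smoothC cy)) => N.
  have N0 : 0 < N.+1%:R :> R by rewrite ltr0n.
  rewrite -ler_pdivrMl//; apply: concave_segment => //.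
  by rewrite invr_ge0 ler0n/= invf_le1 ?ltr0n// ler1n.
have Ggap : (1 - (expR 1)^-1) * G o - (1 + eps) * G y
    <= (expR 1)^-1 * dot (barG_grad m G y) (o - y).
  have := barG_progress m_gt0 smoothG nnG monoG drG cy co.
  rewrite ler_pdivlMl// -/eps; congr (_ <= _).
  by field; rewrite gt_eqF.
have gap : (1 - (expR 1)^-1) * G o + C o - (1 + eps) * G y - C y
    <= dot (dphi y) (s - y).
  have := smax _ Po; rewrite dotBr.
  move: Cgap Ggap; rewrite -dotZl.
  have -> : dot (dphi y) o = dot (dphi y) (o - y) + dot (dphi y) y.
    by rewrite dotBr subrK.
  rewrite {2}/dphi /fw_direction dotDl; lra.
have := ler_wpM2l (ltW eps_gt0) gap.
move=> h1 h2 h3; apply: le_trans h3.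
have h4 := ler_wpM2l (sqr_ge0 eps) h2.
lra.
Qed.

(** The quantity [delta] below is a common lower bound on the progress per
    iteration and unit of [eps]; were it above [eps * F o], the total progress
    would exceed the range of [phi]. *)
Lemma frank_wolfe_guarantee (N : nat) (y s : nat -> 'rV[R]_n) (v : 'rV[R]_n) :
  trajectory P m G C N.+1 y s ->
  argmax [set y i | i in [set i | (i <= N)%N]] (G \+ C) v ->
  (1 - ln eps) / eps ^+ 2 <= N.+1%:R ->
  (1 - (expR 1)^-1 - 2 * eps) * G o + (1 - 2 * eps) * C o - 4 * eps * L * D ^+ 2
    <= (G \+ C) v.
Proof.
move=> tr [[iv iN yv] vmax] NT; have [_ _ convP] := bodyP.
have Py := trajectory_in_body m_gt0 convP tr; have [Py0 smax yS] := tr.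
have [Po omax] := oP.
set Fv := (G \+ C) v; set Fo := G o + C o.
have Fvo : Fv <= Fo by apply: omax; rewrite -yv; apply/Py/ltnW.
have co := Pcube Po; have Go := nnG co; have Co := nnC co.
pose delta := (1 - (expR 1)^-1) * G o + C o - (1 + eps) * Fv - 4 * eps * L * D ^+ 2.
have step i : (i <= N)%N -> eps * delta <= phi (y i.+1) - phi (y i).
  move=> iN'; rewrite yS//; apply: le_trans (phi_step _ (smax _ iN')).
    rewrite ler_pM2l// /delta lerD2r.
    have : (G \+ C) (y i) <= Fv by apply: vmax; exists i.
    move=> /=; have cyi := Pcube (Py i (leqW iN')).
    have := ler_wpM2l (ltW eps_gt0) (nnC cyi) => h1 h2.
    have h3 : (1 + eps) * (G (y i) + C (y i)) <= (1 + eps) * Fv.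
      by rewrite ler_wpM2l// addr_ge0// ltW.
    lra.
  exact/Py/leqW.
have total : N.+1%:R * (eps * delta) <= (1 - ln eps) * Fo.
  have -> : N.+1%:R * (eps * delta) = \sum_(0 <= i < N.+1) eps * delta.
    by rewrite sumr_const_nat subn0 mulr_natl.
  apply: (@le_trans _ _ (phi (y N.+1) - phi (y 0%N))).
    rewrite -(@telescope_sumr _ 0 N.+1 (fun i => phi (y i)))//; apply: ler_sum_nat => i; rewrite ltnS => iN'.
    exact: step.
  have cyN := Pcube (Py _ (leqnn N.+1)); have cy0 := Pcube Py0.
  have p0 : 0 <= phi (y 0%N).
    by rewrite addr_ge0 ?nnC// mulr_ge0 ?invr_ge0 ?expR_ge0// barG_ge0.
  have pN : phi (y N.+1) <= (1 - ln eps) * G (y N.+1) + C (y N.+1).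
    rewrite lerD2r ler_pdivrMl// mulrA; exact: barG_le.
  have ln0 : ln eps <= 0 by exact: ln_le0.
  have := omax _ (Py _ (leqnn N.+1)); rewrite /= -/Fo.
  have := nnC cyN; have := nnG cyN.
  move: (G (y N.+1)) (C (y N.+1)) p0 pN => g c p0 pN g0 c0 gc.
  have : (1 - ln eps) * (g + c) <= (1 - ln eps) * Fo by apply: ler_wpM2l => //; lra.
  have : 0 <= (- ln eps) * c by rewrite mulr_ge0// oppr_ge0.
  lra.
have deltaF : delta <= eps * Fo.
  have q0 : 0 <= 1 - ln eps by rewrite subr_ge0 (le_trans (ln_le0 eps_le1)).
  rewrite leNgt; apply/negP => dF.
  have F0 : 0 <= Fo by rewrite addr_ge0.
  have : N.+1%:R * (eps * (eps * Fo)) < N.+1%:R * (eps * delta).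
    by rewrite ltr_pM2l ?ltr0n// ltr_pM2l.
  move=> /lt_le_trans/(_ total); apply/negP; rewrite -leNgt.
  move: NT; rewrite ler_pdivrMr ?exprn_gt0// => NT.
  have := ler_wpM2r F0 NT; lra.
have := ler_wpM2l (ltW eps_gt0) Fvo.
move: deltaF; rewrite /delta /Fo; lra.
Qed.

End Guarantee.

(** * Total correctness and cost of the program *)

(** Existence of a run is part of the judgement because a nondeterministic
    computation may have no result at all; a single exact cost suffices because
    no cost below depends on the choices made. *)
Definition outputs (T : Type) (m : Defs.comp T) (Q : T -> Prop) (t g : nat) : Prop :=
  m !=set0 /\
  forall x c, m (x, c) -> [/\ Q x, time c = t & grad_calls c = g].

Section Outputs.
Context {T U : Type}.

Lemma outputs_pick (A : set T) (c : cost) (Q : T -> Prop) : A !=set0 ->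
  A `<=` Q -> outputs (Defs.pick A c) Q (time c) (grad_calls c).
Proof.
move=> [x Ax] AQ; split; first by exists (x, c).
by move=> z d [/= /AQ Qz ->].
Qed.

Lemma outputs_ops k (x : T) (Q : T -> Prop) : Q x -> outputs (ops k x) Q k 0.
Proof. by move=> Qx; apply: outputs_pick => [|_ ->//]; exists x. Qed.

Lemma outputs_bind (m : Defs.comp T) (f : T -> Defs.comp U) (Q : T -> Prop)
    (Q' : U -> Prop) t g t' g' :
  outputs m Q t g -> (forall x, Q x -> outputs (f x) Q' t' g') ->
  outputs (bind m f) Q' (t + t') (g + g').
Proof.
move=> [[[x c] mx] mQ] fQ; split.
- have [Qx _ _] := mQ _ _ mx; have [[[z d] fz] _] := fQ _ Qx.
  by exists (z, add_cost c d), x, c, d.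
- move=> z cz [x' [c' [d [mx' fz /= ->]]]].
  have [Qx <- <-] := mQ _ _ mx'; have [_ /(_ _ _ fz)] := fQ _ Qx.
  by move=> [Qz <- <-].
Qed.

End Outputs.

Lemma outputs_loop (T : Type) (body : nat -> T -> Defs.comp T) (I : nat -> T -> Prop)
    (i k : nat) (x : T) t g :
  (forall j z, (i <= j < i + k)%N -> I j z -> outputs (body j z) (I j.+1) t g) ->
  I i x -> outputs (loop body i k x) (I (i + k)%N) (k * t.+1).+1 (k * g).
Proof.
elim: k i x => [|k IHk] i x bodyI Ix /=.
  by rewrite addn0; exact: outputs_ops.
rewrite (_ : (k.+1 * t.+1).+1 = 1 + (t + (k * t.+1).+1))%N; last by lia.
rewrite (_ : k.+1 * g = 0 + (g + k * g))%N; last by lia.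
apply: (outputs_bind (outputs_ops 1 (Logic.I : (fun=> True) tt))) => _ _.
apply: outputs_bind; first by apply: bodyI Ix; lia.
move=> z Iz; rewrite addnS -addSn; apply: IHk => // j w ijk.
by apply: bodyI; lia.
Qed.

Lemma outputs_gradient_oracle {R : realType} {n : nat} (f : 'rV[R]_n -> R) x :
  outputs (gradient_oracle f x) (eq^~ (gradient f x)) 0 1.
Proof. by apply: outputs_pick => [|_ ->//]; exists (gradient f x). Qed.

Lemma outputs_objective {R : realType} {n : nat} (G C : 'rV[R]_n -> R) x :
  outputs (objective G C x) (eq^~ ((G \+ C) x)) 1 0.
Proof.
apply: (@outputs_bind _ _ _ _ (eq^~ (G x)) _ 0 0 1 0) => [|_ ->].
  by apply: outputs_pick => [|_ ->//]; exists (G x).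
apply: (@outputs_bind _ _ _ _ (eq^~ (C x)) _ 0 0 1 0) => [|_ ->].
  by apply: outputs_pick => [|_ ->//]; exists (C x).
exact: outputs_ops.
Qed.

(** By compactness; hence the linear solver always has an answer. *)
Lemma linear_argmax {R : realType} {n : nat} (P : set 'rV[R]_n) (u : 'rV[R]_n) :
  convex_body P -> argmax P (dot u) !=set0.
Proof.
move=> [P0 cptP _].
have cu : continuous (dot u).
  apply: continuous_big => [|i _]; first exact: (@add_continuous R^o).
  by move=> x; apply: continuousM; [exact: cst_continuous|exact: coord_continuous].
have [c Pc cmax] := compact_EVT_max P0 cptP (continuous_subspaceT cu).
exists c; split; first by rewrite inE in Pc.
by move=> z Pz; apply: cmax; rewrite inE.
Qed.

Lemma outputs_linear_solver {R : realType} {n : nat} S (P : set 'rV[R]_n) u :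
  convex_body P ->
  outputs (linear_solver S P u) (argmax P (dot u)) S 0.
Proof. by move=> bP; apply: outputs_pick => //; exact: linear_argmax. Qed.

Lemma outputs_better {R : realType} {T : Type} (p q : T * R) :
  outputs (better p q) (argmax [set p; q] snd) 1 0.
Proof.
apply: outputs_pick => //.
have [pq|qp] := leP p.2 q.2.
- by exists q; split; [right|move=> z [->|->]].
- by exists p; split; [left|move=> z [->|->]; rewrite // ltW].
Qed.

Lemma outputs_weaken (T : Type) (m : Defs.comp T) (Q Q' : T -> Prop) t t' g g' :
  outputs m Q t g -> (forall x, Q x -> Q' x) -> t = t' -> g = g' ->
  outputs m Q' t' g'.
Proof.
move=> [m0 mQ] QQ' <- <-; split=> // x c /mQ[Qx tc gc].
by split=> //; exact: QQ'.
Qed.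

Lemma outputs_best {R : realType} {n : nat} (G C : 'rV[R]_n -> R) y
    (ys : seq 'rV[R]_n) :
  outputs (best G C y ys) (argmax [set x | x \in y :: ys] (G \+ C))
    (1 + (size ys * 2 + 0)) 0.
Proof.
pose Q (zs : seq 'rV[R]_n) (p : 'rV[R]_n * R) :=
  argmax [set x | x \in zs] (G \+ C) p.1 /\ p.2 = (G \+ C) p.1.
apply: (@outputs_bind _ _ _ _ _ _ _ 0 _ 0) (outputs_objective G C y) _ => _ ->.
apply: (@outputs_bind _ _ _ _ (Q (y :: ys)) _ _ 0 _ 0) => [|p [pmax _]]; last first.
  exact: outputs_ops.
(* generalize over the accumulator; zs collects the points compared so far *)
pose step acc z := let* p := acc in let* w := objective G C z in better p (z, w).
suff foldP acc zs t : outputs acc (Q zs) t 0 ->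
    outputs (foldl step acc ys) (Q (zs ++ ys)) (t + size ys * 2) 0.
  rewrite -[(size ys * 2)%N]add0n; apply: (foldP _ [:: y]).
  apply: outputs_ops; split=> //; split; first exact: mem_head.
  by move=> z /=; rewrite inE => /eqP->.
elim: ys acc zs t => [|z ys IHys] acc zs t accQ /=.
  by rewrite cats0 addn0.
rewrite -cat_rcons mulSn addnA; apply: IHys.
apply: (@outputs_bind _ _ _ _ _ _ _ 0 _ 0) accQ _ => p [[pzs pmax] pv].
apply: (@outputs_bind _ _ _ _ _ _ 1 0 1 0) (outputs_objective G C z) _ => _ ->.
apply: outputs_weaken (outputs_better _ _) _ erefl erefl => q [qpz qmax].
have pq := qmax p (or_introl erefl).
have zq := qmax (z, (G \+ C) z) (or_intror erefl).
have qv : q.2 = (G \+ C) q.1 by case: qpz => ->.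
split=> //; split.
  rewrite /= mem_rcons inE; case: qpz => -> /=; first by rewrite pzs orbT.
  by rewrite eqxx.
move=> w wzs; rewrite -qv; move: wzs; rewrite /= mem_rcons inE.
move=> /orP[/eqP->//|/pmax/le_trans]; apply.
by rewrite -pv.
Qed.

Lemma outputs_barG_gradient {R : realType} {n : nat} (G : 'rV[R]_n -> R) (m : nat)
    (x : 'rV[R]_n) :
  outputs (barG_gradient m%:R^-1 G x) (eq^~ (barG_grad m G x))
    (2 + (n + ((m * (3 + 3 * n).+1).+1 + n))) m.
Proof.
set eps := m%:R^-1.
pose acc k : 'rV[R]_n :=
  \sum_(1 <= j < k) expR (eps * j%:R) *: gradient G ((eps * j%:R) *: x).
apply: (@outputs_bind _ _ _ _ (eq^~ m) _ _ 0 _ m) => [|_ ->].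
  by apply: outputs_ops; rewrite /eps invrK natrK.
apply: (@outputs_bind _ _ _ _ (eq^~ 0) _ _ 0 _ m) => [|_ ->].
  exact: outputs_ops.
rewrite -[X in outputs _ _ _ X]addn0.
apply: (@outputs_bind _ _ _ _ (eq^~ (acc m.+1))) => [|_ ->]; last exact: outputs_ops.
rewrite -[X in outputs _ _ _ X]muln1 -[in acc _]add1n.
apply: (@outputs_loop _ _ (fun k => eq^~ (acc k))); last first.
  by rewrite /acc big_geq.
move=> j _ /andP[j0 _] ->.
rewrite (_ : 3 + 3 * n = 2 + (n + (0 + (1 + (n + n)))))%N; last by lia.
apply: (@outputs_bind _ _ _ _ _ _ _ 0 _ 1) (outputs_ops _ erefl) _ => _ <-.
apply: (@outputs_bind _ _ _ _ _ _ _ 0 _ 1) (outputs_ops _ erefl) _ => _ <-.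
apply: (@outputs_bind _ _ _ _ _ _ _ 1 _ 0) (outputs_gradient_oracle _ _) _ => _ ->.
apply: (@outputs_bind _ _ _ _ _ _ _ 0 _ 0) (outputs_ops _ erefl) _ => _ <-.
apply: (@outputs_bind _ _ _ _ _ _ _ 0 _ 0) (outputs_ops _ erefl) _ => _ <-.
by apply: outputs_ops; rewrite /acc [RHS]big_nat_recr.
Qed.

(** Summed in the order of the program, so that the sequencing rule applies to it
    without rearrangement. *)
Definition step_time (n m S : nat) : nat :=
  2 + (n + ((m * (3 + 3 * n).+1).+1 + n)) +
  (0 + (2 + 2 * n + (S + (1 + 3 * n + 1)))).

Section Program.
Context {R : realType} {n : nat} {P : set 'rV[R]_n} {G C : 'rV[R]_n -> R}
  {m S : nat}.
Let eps : R := m%:R^-1.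
Hypothesis (bodyP : convex_body P).

Lemma outputs_frank_wolfe_step st :
  outputs (frank_wolfe_step S eps P G C st)
    (fun st' => exists2 s, argmax P (dot (fw_direction m G C st.1)) s &
       st' = ((1 - eps) *: st.1 + eps *: s, st.1 :: st.2))
    (step_time n m S) m.+1.
Proof.
rewrite /step_time -[m.+1]addn1.
apply: outputs_bind (outputs_barG_gradient G m st.1) _ => _ ->.
apply: (@outputs_bind _ _ _ _ _ _ _ 1 _ 0) (outputs_gradient_oracle _ _) _ => _ ->.
apply: (@outputs_bind _ _ _ _ _ _ _ 0 _ 0) (outputs_ops _ erefl) _ => _ <-.
apply: (@outputs_bind _ _ _ _ _ _ _ 0 _ 0) (outputs_linear_solver _ _ bodyP) _ => s smax.
apply: (@outputs_bind _ _ _ _ _ _ _ 0 _ 0) (outputs_ops _ erefl) _ => _ <-.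
by apply: outputs_ops; exists s.
Qed.

(* The state lists the points already left, the most recent one first. *)
Let traced (i : nat) (st : 'rV[R]_n * seq 'rV[R]_n) : Prop :=
  exists2 ys : (nat -> 'rV[R]_n) * (nat -> 'rV[R]_n),
    trajectory P m G C i ys.1 ys.2 & st = (ys.1 i, rev (mkseq ys.1 i)).

Lemma outputs_frank_wolfe_program : let N := last_index eps in
  outputs (frank_wolfe_program S eps P G C)
    (fun v => exists2 ys : (nat -> 'rV[R]_n) * (nat -> 'rV[R]_n),
       trajectory P m G C N.+1 ys.1 ys.2 &
       argmax [set ys.1 i | i in [set i | (i <= N)%N]] (G \+ C) v)
    (n + (S + (10 + ((N.+1 * (step_time n m S).+1).+1 + (1 + (N * 2 + 0))))))
    (N.+1 * m.+1).
Proof.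
move=> N; rewrite /frank_wolfe_program.
apply: (@outputs_bind _ _ _ _ _ _ _ 0 _ (N.+1 * m.+1)) (outputs_ops _ erefl) _ => _ <-.
apply: (@outputs_bind _ _ _ _ _ _ _ 0 _ (N.+1 * m.+1))
  (outputs_linear_solver _ _ bodyP) _ => y0 [Py0 _].
apply: (@outputs_bind _ _ _ _ _ _ _ 0 _ (N.+1 * m.+1)) (outputs_ops _ erefl) _ => _ <-.
rewrite -/N -[X in outputs _ _ _ X]addn0.
apply: (@outputs_bind _ _ _ _ (traced N.+1)) => [|_ [[y s] /= tr ->/=]].
  apply: (@outputs_loop _ _ traced 0).
    move=> i _ _ [[y s] /= [yP smax yS] ->].
    apply: outputs_weaken (outputs_frank_wolfe_step _) _ erefl erefl => _ [s' s'max ->].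
    (* append the new point and the new maximizer to the trajectory *)
    exists (fun j => if (j <= i)%N then y j else (1 - eps) *: y i + eps *: s',
            fun j => if (j < i)%N then s j else s') => /=; last first.
      rewrite ltnn -rev_rcons -mkseqS; congr (_, rev _).
      by apply/eq_in_map => j; rewrite mem_iota add0n /= ltnS => ->.
    split=> //= j; rewrite ltnS leq_eqVlt => /orP[/eqP->|ji].
    - by rewrite eqxx ltnn.
    - by rewrite ji orbT; exact: smax.
    - by rewrite ltnn eqxx.
    - by rewrite ji orbT; exact: yS.
  (* before the first iteration, only the value of y at 0 matters *)
  by exists (fun=> y0, fun=> y0).
rewrite mkseqS rev_rcons /=.
apply: outputs_weaken (outputs_best _ _ _ _) _ _ erefl; last first.
  by rewrite size_rev size_mkseq.
move=> v; rewrite -rev_rcons -mkseqS => -[vin vmax]; exists (y, s) => //.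
have inE' x : (x \in rev (mkseq y N.+1)) <-> [set y i | i in [set i | (i <= N)%N]] x.
  rewrite mem_rev; split.
  - by move=> /mapP[i]; rewrite mem_iota add0n ltnS => iN ->; exists i.
  - by move=> [i /= iN <-]; apply: map_f; rewrite mem_iota add0n ltnS.
split; first exact/inE'.
by move=> z /inE' zin; exact: vmax.
Qed.

End Program.

(** * The theorem *)

(** The two descriptions of a run differ in the gradient of [barG] only, and the
    iterates stay in the body, where the explicit formula is valid. *)
Lemma frank_wolfeP {R : realType} {n : nat} (P : set 'rV[R]_n)
    (G C : 'rV[R]_n -> R) (L : R) (m : nat) (v : 'rV[R]_n) :
  (0 < m)%N -> smooth L G -> convex_body P -> P `<=` cube ->
  let N := last_index (m%:R^-1 : R) in
  frank_wolfe m%:R^-1 P G C v <->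
  exists2 ys : (nat -> 'rV[R]_n) * (nat -> 'rV[R]_n),
    trajectory P m G C N.+1 ys.1 ys.2 &
    argmax [set ys.1 i | i in [set i | (i <= N)%N]] (G \+ C) v.
Proof.
move=> m0 smG [_ _ cP] Pcube N.
have dirE x : P x -> (expR 1)^-1 *: gradient (barG m%:R^-1 G) x + gradient C x
    = fw_direction m G C x.
  move=> /Pcube cx; rewrite /fw_direction (gradientE cx (g := barG_grad m G x))//.
  by apply: barG_is_gradient => //; exact: smG.
split=> [[y [s [Py0 smax yS vmax]]]|[[y s] /= tr vmax]].
- have Py : forall i, (i <= N.+1)%N -> P (y i).
    apply: (@iterates_in_body _ _ P _ N.+1 y s cP _ Py0 _ yS).
      by rewrite invr_ge0 ler0n/= invf_le1 ?ltr0n// ler1n.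
    by move=> i /smax[].
  exists (y, s) => //; split=> // i iN /=.
  by rewrite -dirE; [exact: smax|exact/Py/ltnW].
- have Py := trajectory_in_body m0 cP tr; have [Py0 smax yS] := tr.
  exists y, s; split=> // i iN.
  by rewrite dirE; [exact: smax|exact/Py/leqW].
Qed.

Lemma last_index_bounds {R : realType} (eps : R) : 0 < eps -> eps <= 1 ->
  (1 - ln eps) / eps ^+ 2 <= (last_index eps)%:R
    < (1 - ln eps) / eps ^+ 2 + 1.
Proof.
move=> e0 e1; rewrite /last_index /fw_beta mulKf ?gt_eqF ?expR_gt0//.
set z := _ / _.
have z0 : 0 <= z.
  by rewrite divr_ge0 ?sqr_ge0// subr_ge0 (le_trans (ln_le0 e1)).
have c0 : 0 <= Num.ceil z by rewrite ceil_ge0 (lt_le_trans _ z0).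
rewrite natr_absz ger0_norm//; apply/andP; split; first exact: ceil_ge.
by have /andP[] := ceil_itv z; rewrite intrB ltrBlDr.
Qed.

(** Since [ln eps^-1 >= 1 - eps >= 3 / 4], the additive constants are absorbed by
    the logarithm. *)
Lemma ln_inv_ge {R : realType} (eps : R) : 0 < eps -> eps < 1 / 4 ->
  3 / 4 <= ln eps^-1.
Proof.
move=> e0 e4; rewrite lnV ?posrE//.
have /le_ln1Dx : -1 < eps - 1 by lra.
rewrite subrKC; lra.
Qed.

Lemma iterations_bound {R : realType} (eps : R) : 0 < eps -> eps < 1 / 4 ->
  (last_index eps).+1%:R <= 4 * (eps ^- 2 * ln eps^-1).
Proof.
move=> e0 e4; have l0 := ln_inv_ge e0 e4.
have /andP[_ h] : (1 - ln eps) / eps ^+ 2 <= (last_index eps)%:R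
    < (1 - ln eps) / eps ^+ 2 + 1 by apply: last_index_bounds => //; lra.
rewrite -natr1; move: l0 h; rewrite lnV ?posrE// => l0 h.
have i16 : 16 <= eps ^- 2.
  rewrite -[16]invrK lef_pV2 ?posrE ?exprn_gt0 ?invr_gt0//; nra.
move: (eps ^- 2) (ln eps) i16 l0 h => X l i16 l0 h; nra.
Qed.

Lemma total_time_bound (N n m S : nat) : (0 < n)%N -> (0 < m)%N ->
  (n + (S + (10 + ((N.+1 * (step_time n m S).+1).+1 + (1 + (N * 2 + 0)))))
    <= 100 * (N.+1 * (n * m + S)))%N.
Proof.
move=> n0 m0; rewrite /step_time.
have nm : (n <= n * m)%N by rewrite leq_pmulr.
have mn : (m <= n * m)%N by rewrite leq_pmull.
have -> : (m * (3 + 3 * n).+1 = 4 * m + 3 * (n * m))%N by nia.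
move: (n * m)%N nm mn => q nq mq.
set s := (2 + _ + _).+1; have sq : (s <= 40 * (q + S))%N by rewrite /s; lia.
move: s sq => s sq; set W := (N.+1 * (q + S))%N.
have h1 : (N.+1 * s <= 40 * W)%N by rewrite /W mulnCA leq_mul2l sq orbT.
have h2 : (N.+1 <= W)%N by rewrite /W leq_pmulr// addn_gt0 (leq_trans n0).
have h3 : (q + S <= W)%N by rewrite /W leq_pmull.
move: (N.+1 * s)%N W h1 h2 h3 => A W h1 h2 h3; lia.
Qed.

Theorem theorem3p18 :
  exists K1 K2 : nat,
  forall (R : realType) (n : nat) (P : set 'rV[R]_n) (G C : 'rV[R]_n -> R)
         (L D eps : R) (o : 'rV[R]_n) (S : nat),
    (0 < n)%N ->
    convex_body P -> P `<=` cube ->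
    nonnegative G -> cube_monotone G -> smooth L G -> dr_submodular G ->
    nonnegative C -> smooth L C -> concave C ->
    argmax P (G \+ C) o ->
    (exists2 x, argmax P (@norm2 R n) x & D = norm2 x) ->
    0 < eps < 1 / 4 -> eps^-1 \is a Num.int ->
    [/\ exists (y : 'rV[R]_n) (c : cost),
          frank_wolfe_program S eps P G C (y, c),
        forall (y : 'rV[R]_n) (c : cost),
          frank_wolfe_program S eps P G C (y, c) ->
          [/\ frank_wolfe eps P G C y,
              (time c)%:R <=
                K1%:R * (eps ^- 2 * (n%:R / eps + S%:R) * ln eps^-1) &
              (grad_calls c)%:R <= K2%:R * (eps ^- 3 * ln eps^-1)] &
        forall y : 'rV[R]_n, frank_wolfe eps P G C y ->
          (G \+ C) y >=
            (1 - (expR 1)^-1 - 4 * eps * ln eps^-1) * G o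
            + (1 - 4 * eps * ln eps^-1) * C o
            - 4 * eps * L * D ^+ 2].
Proof.
exists 400%N, 8%N.
move=> R n P G C L D eps o S n0 bodyP Pcube nnG monoG smG drG nnC smC concC oP.
move=> [xD [_ xDmax] DE] /andP[e0 e4] epsint.
have [m epsE] : exists m : nat, eps = m%:R^-1.
  have : eps^-1 \is a Num.nat by rewrite -intrEge0// invr_ge0 ltW.
  by move=> /natrP[m em]; exists m; rewrite -em invrK.
have m0 : (0 < m)%N.
  by rewrite lt0n; apply/eqP => m0; move: e0; rewrite epsE m0 invr0 ltxx.
have l34 := ln_inv_ge e0 e4; have iter := iterations_bound e0 e4.
have i0 : 0 < eps^-1 by rewrite invr_gt0.
have /andP[lastlb _] : (1 - ln eps) / eps ^+ 2 <= (last_index eps)%:R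
    < (1 - ln eps) / eps ^+ 2 + 1 by apply: last_index_bounds => //; lra.
have mE : m%:R = eps^-1 :> R by rewrite epsE invrK.
have [run0 runs] := outputs_weaken (@outputs_frank_wolfe_program R n P G C m S bodyP)
  (fun v => proj2 (frank_wolfeP C v m0 smG bodyP Pcube)) erefl erefl.
rewrite -epsE in run0 runs.
split.
- by move: run0 => [[y c] yc]; exists y, c.
- move=> y c /runs[fw -> ->]; split=> //.
  + apply: (@le_trans _ _ (100 * ((last_index eps).+1 * (n * m + S)))%:R).
      by rewrite ler_nat epsE; exact: total_time_bound.
    rewrite !natrM natrD natrM mE.
    have q0 : 0 <= n%:R / eps + S%:R :> R by rewrite addr_ge0// divr_ge0// ltW.
    have := ler_wpM2r q0 iter; lra.
  + rewrite natrM -(natr1 m) mE.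
    have h1 : eps^-1 + 1 <= 2 * eps^-1.
      have : 1 <= eps^-1 by rewrite invf_ge1//; lra.
      lra.
    have -> : eps ^- 3 = eps ^- 2 * eps^-1 by rewrite exprSr invfM mulrC.
    have h2 : (last_index eps).+1%:R * (eps^-1 + 1)
        <= 4 * (eps ^- 2 * ln eps^-1) * (2 * eps^-1).
      by apply: ler_pM => //; rewrite addr_ge0// ltW.
    lra.
- move=> y; rewrite {1}epsE => /(frank_wolfeP _ _ m0 smG bodyP Pcube).
  rewrite -epsE => -[[ys s] /= tr ymax].
  have normP x : P x -> norm2 x <= D by move=> /xDmax; rewrite DE.
  have := frank_wolfe_guarantee n0 m0 bodyP Pcube nnG monoG smG drG nnC smC
    concC oP normP tr ymax.
  rewrite -epsE => guarantee; apply: le_trans (guarantee _); last first.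
    by apply: le_trans lastlb _; rewrite ler_nat.
  have [Po _] := oP; have co := Pcube _ Po.
  have Go := nnG _ co; have Co := nnC _ co.
  rewrite lerD2r.
  have c2 : 2 * eps <= 4 * eps * ln eps^-1 by nra.
  have h1 := ler_wpM2r Go c2; have h2 := ler_wpM2r Co c2.
  lra.
Qed.
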